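(* For all $n\geq 1$ and $\sigma\in\{132,231\}$, the number of desarrangements of length $n$ avoiding both $312$ and $\sigma$ is $d_n(312,\sigma)=J_{n-1}$, the $(n-1)$st Jacobsthal number.
   Context: Permutations are in one-line notation. An index $i\in[n-1]$ is a descent of $\pi\in\mathfrak{S}_n$ if $\pi_i>\pi_{i+1}$; $i\in[n]$ is an ascent if it is not a descent (so $n$ is always an ascent). A desarrangement is a permutation whose first ascent is even. $d_n(\Pi)$ is the number of desarrangements in $\mathfrak{S}_n$ avoiding every pattern in $\Pi$ ($\pi$ avoids $\sigma$ if no subsequence of $\pi$ has the same relative order as $\sigma$). The Jacobsthal numbers are defined by $J_0=0$, $J_1=1$, $J_n=J_{n-1}+2J_{n-2}$ for $n\ge2$. *)

(* Defs.v *)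
From mathcomp Require Import all_boot all_fingroup.

Set Implicit Arguments.
Unset Strict Implicit.
Unset Printing Implicit Defensive.

(* 'S_n permutes {0, .., n-1}; words use the letters 1, .., n. *)
Definition one_line (n : nat) (s : 'S_n) : seq nat :=
  [seq (s i : nat).+1 | i : 'I_n].

(* Positions are numbered from 1, so the letter at position i is nth 0 w i.-1. *)
Definition descent (w : seq nat) (i : nat) : bool :=
  (1 <= i < size w) && (nth 0 w i < nth 0 w i.-1).

Definition ascent (w : seq nat) (i : nat) : bool :=
  (1 <= i <= size w) && ~~ descent w i.

Definition desarrangement (w : seq nat) : bool :=
  [exists i : 'I_(size w).+1,
     [&& ascent w i, [forall j : 'I_(size w).+1, (j < i) ==> ~~ ascent w j]
       & ~~ odd i]].

(* f lists, in increasing order, the positions (from 0) of a subsequence of w. *)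
Definition contains (w p : seq nat) : bool :=
  [exists f : {ffun 'I_(size p) -> 'I_(size w)},
     [forall a : 'I_(size p), forall b : 'I_(size p),
        ((a < b) ==> (f a < f b)) &&
        ((nth 0 w (f a) < nth 0 w (f b)) == (nth 0 p a < nth 0 p b))]].

Definition avoids (w p : seq nat) : bool := ~~ contains w p.

Definition d (n : nat) (Pi : seq (seq nat)) : nat :=
  #|[set s : 'S_n | desarrangement (one_line s) && all (avoids (one_line s)) Pi]|.

Fixpoint jacobsthal (n : nat) : nat :=
  match n with
  | 0 => 0
  | 1 => 1
  | (m.+1 as k).+1 => jacobsthal k + 2 * jacobsthal m
  end.

(* Main.v *)
Require Import Defs.
From mathcomp Require Import all_boot all_fingroup.
From mathcomp Require Import zify.

(** Every permutation of n + 1 letters arises uniquely from one of n letters by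
    prepending a letter c and shifting up the letters that are at least c.  For
    a nonempty avoider with first letter h, the result is again an avoider iff
    c is h + 1 or h (for sigma = 132), resp. h + 1 or 0 (for sigma = 231),
    letters being counted from 0.  The choice c = h + 1 creates a descent and so
    increments the first ascent; the other one puts the first ascent at
    position 1.  If G n and H n count the avoiders with even, resp. odd, first
    ascent, then G (n + 1) = H n and H (n + 1) = 2 G n + H n, which is the
    Jacobsthal recurrence. *)

Set Implicit Arguments.
Unset Strict Implicit.
Unset Printing Implicit Defensive.

(** * First ascents of words *)

Fixpoint first_ascent (w : seq nat) : nat :=
  match w with
  | x :: (y :: _) as w' => if y < x then (first_ascent w').+1 else 1
  | _ => 1
  end.

Lemma first_ascent_cons2 x y w :
  first_ascent (x :: y :: w) = if y < x then (first_ascent (y :: w)).+1 else 1.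
Proof. by []. Qed.

Lemma first_ascent_gt0 w : 0 < first_ascent w.
Proof. by case: w => [|x [|y w]] //=; case: ifP. Qed.

Lemma ascent_consS x w j : 0 < j -> ascent (x :: w) j.+1 = ascent w j.
Proof. by case: j => [|j] // _; rewrite /ascent /descent /= !ltnS. Qed.

Lemma ascent_first_ascent w : 0 < size w -> ascent w (first_ascent w).
Proof.
elim: w => [|x [|y w] IHw] // _.
rewrite first_ascent_cons2; case: ifP => [_|yx].
  by rewrite ascent_consS ?IHw ?first_ascent_gt0.
by rewrite /ascent /descent /= yx.
Qed.

Lemma not_ascent_lt_first w j : j < first_ascent w -> ~~ ascent w j.
Proof.
elim: w j => [|x [|y w] IHw] [|j] //.
rewrite first_ascent_cons2; case: ifP => [yx|_] //.
case: j => [|j] ltj; first by rewrite /ascent /descent /= yx.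
by rewrite ascent_consS // IHw.
Qed.

Lemma ascent_le_size w j : ascent w j -> j < (size w).+1.
Proof. by case/andP=> /andP[]. Qed.

Lemma desarrangementE w : desarrangement w = ~~ odd (first_ascent w).
Proof.
have [/eqP/nilP->|w_gt0] := posnP (size w).
  (* The empty word has no ascent, and [first_ascent] gives it the odd value 1. *)
  by apply/existsP => -[[[|i] lti]].
have asc := ascent_first_ascent w_gt0.
apply/existsP/idP => [[i /and3P[asci /forallP mini evi]]|ev].
  suff <- : i = first_ascent w :> nat by [].
  case: (ltngtP i (first_ascent w)) => // [lti|gti].
    by rewrite (negPf (not_ascent_lt_first lti)) in asci.
  by have := mini (Ordinal (ascent_le_size asc)); rewrite /= gti asc.
exists (Ordinal (ascent_le_size asc)); rewrite /= asc ev andbT.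
by apply/forallP=> j; apply/implyP=> /not_ascent_lt_first.
Qed.

Lemma first_ascent_map f w :
  {mono f : x y / x < y} -> first_ascent (map f w) = first_ascent w.
Proof.
move=> fM; elim: w => [|x [|y w] IHw] //.
by rewrite first_ascent_cons2 -IHw -fM.
Qed.

Lemma ltn_bump h : {mono bump h : x y / x < y}.
Proof. by move=> x y; rewrite !ltnNge leq_bump2. Qed.

(** * Prepending a letter to a permutation *)

Lemma lift_perm_inj2 n (i : 'I_n.+1) :
  injective (fun x : 'I_n.+1 * 'S_n => lift_perm i x.1 x.2).
Proof.
move=> [c s] [c' s'] /= eq_cs.
have eqc : c = c' by rewrite -(lift_perm_id i c s) eq_cs lift_perm_id.
rewrite -{}eqc in eq_cs *; congr (_, _); apply/permP=> k.
by apply: (@lift_inj _ c); rewrite -!(lift_perm_lift i) eq_cs.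
Qed.

(** Injectivity suffices, because both sides have (n + 1) * n! = (n + 1)! elements. *)
Lemma lift_perm_surj n (i : 'I_n.+1) (t : 'S_n.+1) :
  exists c s, t = lift_perm i c s.
Proof.
have [|g _ gK] := inj_card_bij (@lift_perm_inj2 n i).
  by rewrite card_prod !card_Sn card_ord factS.
by exists (g t).1, (g t).2; rewrite gK.
Qed.

(** Values of [s] start at 0 and letters of words at 1, hence the shift at [c.+1]. *)
Lemma one_line_lift0 n (c : 'I_n.+1) (s : 'S_n) :
  one_line (lift_perm ord0 c s) = c.+1 :: map (bump c.+1) (one_line s).
Proof.
rewrite /one_line /image_mem enum_ordSl /= lift_perm_id -!map_comp.
congr (_ :: _); apply: eq_map => k /=.
by rewrite lift_perm_lift /= /bump !ltnS addnS.
Qed.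

Lemma size_one_line n (s : 'S_n) : size (one_line s) = n.
Proof. by rewrite size_map size_enum_ord. Qed.

Lemma nth_one_line n (s : 'S_n) (i : 'I_n) : nth 0 (one_line s) i = (s i).+1.
Proof. by rewrite (nth_map i) ?size_enum_ord // nth_ord_enum. Qed.

(** A descent at the front moves the first ascent one place to the right and flips its parity;
    otherwise the first ascent is 1, which is odd. *)
Lemma desarrangement_lift0 n (c : 'I_n.+2) (s : 'S_n.+1) :
  desarrangement (one_line (lift_perm ord0 c s)) =
  (s ord0 < c) && ~~ desarrangement (one_line s).
Proof.
have sE : one_line s = (s ord0).+1 :: behead (one_line s).
  by rewrite -nth_one_line; case: (one_line s) (size_one_line s).
rewrite !desarrangementE one_line_lift0.
rewrite -(first_ascent_map (one_line s) (ltn_bump c.+1)).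
rewrite sE; set w := behead _.
have -> : first_ascent (c.+1 :: map (bump c.+1) ((s ord0).+1 :: w)) =
  if s ord0 < c then (first_ascent (map (bump c.+1) ((s ord0).+1 :: w))).+1
  else 1.
  by rewrite /= {1}/bump; congr (if _ then _ else _); lia.
by case: ifP.
Qed.

(** * Occurrences of patterns of length three *)

Lemma containsP n (s : 'S_n) (a b c : nat) : a != b -> a != c -> b != c ->
  reflect (exists i j k : 'I_n, [/\ i < j, j < k, (s i < s j) = (a < b),
             (s i < s k) = (a < c) & (s j < s k) = (b < c)])
          (contains (one_line s) [:: a; b; c]).
Proof.
move=> ab ac bc; rewrite /contains size_one_line.
apply: (iffP existsP) => [[f /forallP fP]|[i [j [k [ij jk sij sik sjk]]]]].
  pose o m (lm : m < 3) : 'I_3 := Ordinal lm.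
  have fo x y := forallP (fP x) y.
  exists (f (@o 0 isT)), (f (@o 1 isT)), (f (@o 2 isT)).
  have /andP[/= -> /eqP] := fo (@o 0 isT) (@o 1 isT).
  have /andP[/= _ /eqP] := fo (@o 0 isT) (@o 2 isT).
  have /andP[/= -> /eqP] := fo (@o 1 isT) (@o 2 isT).
  by rewrite !nth_one_line !ltnS.
(* [contains] compares all ordered pairs; the reversed comparisons follow from the three given ones,
   as the letters on both sides are distinct. *)
have sNlt (x y : 'I_n) : x < y -> (s y < s x) = ~~ (s x < s y).
  move=> xy; rewrite -leqNgt [RHS]leq_eqVlt val_eqE (inj_eq perm_inj).
  by rewrite -val_eqE gtn_eqF.
have pNlt (x y : nat) : x != y -> ~~ (x < y) = (y < x).
  by move=> xy; rewrite -leqNgt leq_eqVlt eq_sym (negPf xy).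
have ik := ltn_trans ij jk.
have sji : (s j < s i) = (b < a) by rewrite sNlt // sij pNlt.
have ski : (s k < s i) = (c < a) by rewrite sNlt // sik pNlt.
have skj : (s k < s j) = (c < b) by rewrite sNlt // sjk pNlt.
(* The default [i] is never reached, since [x < 3]. *)
exists [ffun x : 'I_3 => nth i [:: i; j; k] x].
apply/forallP=> -[x ltx]; apply/forallP=> -[y lty].
rewrite !ffunE !nth_one_line !ltnS.
case: x ltx => [|[|[|x]]] // ltx; case: y lty => [|[|[|y]]] // lty;
  by rewrite /= ?ltnn ?sij ?sik ?sjk ?sji ?ski ?skj ?ij ?ik ?jk eqxx.
Qed.

(** A new occurrence must use the prepended letter, necessarily as its first letter. That letter is
    below the shifted [s j] exactly when [c <= s j]. *)
Lemma lift0_avoids n (c : 'I_n.+1) (s : 'S_n) (x y z : nat) :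
  x != y -> x != z -> y != z ->
  avoids (one_line (lift_perm ord0 c s)) [:: x; y; z] =
  avoids (one_line s) [:: x; y; z] &&
  [forall j : 'I_n, forall k : 'I_n, (j < k) ==>
     ~~ [&& (c <= s j) == (x < y), (c <= s k) == (x < z)
          & (s j < s k) == (y < z)]].
Proof.
move=> xy xz yz.
rewrite /avoids -[X in _ && X]negbK -negb_or; congr (~~ _).
have lt0 (j : 'I_n) :
    ((lift_perm ord0 c s) ord0 < (lift_perm ord0 c s) (lift ord0 j)) =
    (c <= s j).
  by rewrite lift_perm_id lift_perm_lift /= /bump; lia.
have ltl (i j : 'I_n) :
    ((lift_perm ord0 c s) (lift ord0 i) < (lift_perm ord0 c s) (lift ord0 j)) =
    (s i < s j).
  by rewrite !lift_perm_lift /= ltn_bump.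
apply/containsP/orP => // [[i [j [k]]]|].
  case: (unliftP ord0 j) => [j'|] -> ; last by case.
  case: (unliftP ord0 k) => [k'|] -> ; last by case.
  case: (unliftP ord0 i) => [i'|] ->; rewrite ?lt0 !ltl.
    case=> ij jk ? ? ?; left; apply/containsP => //.
    by exists i', j', k'; split.
  case=> _ jk cj ck sjk; right; apply/forallPn; exists j'.
  by apply/forallPn; exists k'; rewrite negb_imply negbK cj ck sjk !eqxx !andbT.
case=> [/containsP[] // i [j [k [? ? ? ? ?]]]|].
  by exists (lift ord0 i), (lift ord0 j), (lift ord0 k); rewrite !ltl.
case/forallPn=> j /forallPn[k]; rewrite negb_imply negbK.
case/and4P=> jk /eqP ? /eqP ? /eqP ?.
by exists ord0, (lift ord0 j), (lift ord0 k); rewrite !lt0 ltl.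
Qed.

Definition avoiders n (Pi : seq (seq nat)) : {set 'S_n} :=
  [set s | all (avoids (one_line s)) Pi].

Definition desarrangements n : {set 'S_n} :=
  [set s | desarrangement (one_line s)].

Lemma d_avoiders n Pi : d n Pi = #|avoiders n Pi :&: desarrangements n|.
Proof. by rewrite /d; apply: eq_card => s; rewrite !inE andbC. Qed.

(** * Counting a class in which every member has two extensions *)

Section BinaryGeneration.

Variable A : forall n, {set 'S_n}.
(** The letter whose prepending creates no descent; the other admissible letter, [lift ord0 h], is h
    + 1. *)
Variable u : forall n, 'I_n.+1 -> 'I_n.+2.
Hypothesis u_le : forall n (h : 'I_n.+1), u h <= h.
Hypothesis A_lift0 : forall n (c : 'I_n.+2) (s : 'S_n.+1),
  (lift_perm ord0 c s \in A n.+2) =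
  (s \in A n.+1) && ((c == u (s ord0)) || (c == lift ord0 (s ord0))).

Let up n (s : 'S_n.+1) := lift_perm ord0 (u (s ord0)) s.
Let down n (s : 'S_n.+1) := lift_perm ord0 (lift ord0 (s ord0)) s.

Let up_inj n : injective (@up n).
Proof. by move=> s t /(@lift_perm_inj2 _ _ (_, _) (_, _)) []. Qed.

Let down_inj n : injective (@down n).
Proof. by move=> s t /(@lift_perm_inj2 _ _ (_, _) (_, _)) []. Qed.

Let des_up n (s : 'S_n.+1) : up s \in desarrangements n.+2 = false.
Proof. by rewrite inE desarrangement_lift0 ltnNge u_le. Qed.

Let des_down n (s : 'S_n.+1) :
  (down s \in desarrangements n.+2) = (s \notin desarrangements n.+1).
Proof. by rewrite !inE desarrangement_lift0 /= /bump /= ltnSn. Qed.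

Let A_S n : A n.+2 = @up n @: A n.+1 :|: @down n @: A n.+1.
Proof.
apply/setP=> t; rewrite inE; have [c [s ->]] := lift_perm_surj ord0 t.
rewrite A_lift0; apply/andP/orP => [[As /orP[]/eqP->]|[]/imsetP[s' As']].
- by left; apply: imset_f.
- by right; apply: imset_f.
- by move/(@lift_perm_inj2 _ _ (_, _) (_, _)) => [-> ->]; rewrite eqxx.
by move/(@lift_perm_inj2 _ _ (_, _) (_, _)) => [-> ->]; rewrite eqxx orbT.
Qed.

(** No [up s] is a desarrangement, and [down] flips the parity of the first ascent. *)
Lemma card_desarrangements_S n :
  #|A n.+2 :&: desarrangements n.+2| = #|A n.+1 :\: desarrangements n.+1|.
Proof.
rewrite -(card_imset _ (@down_inj n)); apply: eq_card => t.
rewrite A_S in_setI in_setU.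
apply/andP/imsetP => [[/orP[]/imsetP[s As ->]]|[s]].
- by rewrite des_up.
- by rewrite des_down => Ds; exists s; rewrite // inE Ds.
by rewrite inE => /andP[Ds As] ->; rewrite des_down Ds imset_f ?orbT.
Qed.

Lemma card_not_desarrangements_S n :
  #|A n.+2 :\: desarrangements n.+2| =
  #|A n.+1| + #|A n.+1 :&: desarrangements n.+1|.
Proof.
rewrite -(card_imset _ (@up_inj n)) -(card_imset _ (@down_inj n)) A_S setDUl.
have -> : @up n @: A n.+1 :\: desarrangements n.+2 = @up n @: A n.+1.
  apply/setDidPl/pred0P => t /=; apply/andP => -[/imsetP[s _ ->]].
  by rewrite des_up.
have -> : @down n @: A n.+1 :\: desarrangements n.+2 =
          @down n @: (A n.+1 :&: desarrangements n.+1).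
  apply/setP=> t; apply/setDP/imsetP => [[/imsetP[s As ->]]|[s /setIP[As Ds] ->]].
    by rewrite des_down negbK => Ds; exists s; rewrite // inE As.
  by rewrite des_down negbK imset_f.
(* The images are disjoint: a common element would give [u h] = h + 1 for its second letter's value
   h in [s], against [u_le]. *)
rewrite cardsU; suff -> : @up n @: A n.+1 :&:
    @down n @: (A n.+1 :&: desarrangements n.+1) = set0 by rewrite cards0 subn0.
apply/setP=> t; rewrite [RHS]inE; apply/setIP => -[/imsetP[s _ ->]].
case/imsetP=> s' _ /(@lift_perm_inj2 _ _ (_, _) (_, _)).
case=> /(congr1 val) /= eq_u eq_s.
by have := u_le (s ord0); rewrite eq_u eq_s /bump ltnn.
Qed.

Lemma card_binary_desarrangements n :
  #|A 1| = 1 -> #|A n.+1 :&: desarrangements n.+1| = jacobsthal n.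
Proof.
(* Both counts go through the induction together, since each recurrence refers to the complementary
   one. *)
move=> A1; suff [] : #|A n.+1 :&: desarrangements n.+1| = jacobsthal n /\
  #|A n.+1 :\: desarrangements n.+1| = jacobsthal n.+1 by [].
elim: n => [|n [IHd IHn]]; last first.
  rewrite card_desarrangements_S card_not_desarrangements_S.
  rewrite -(cardsID (desarrangements n.+1) (A n.+1)) IHd IHn.
  by split=> //=; lia.
have D1 : desarrangements 1 = set0.
  apply/setP=> s; rewrite !inE desarrangementE.
  by case: (one_line s) (size_one_line s) => [|x []].
by rewrite D1 setI0 setD0 cards0.
Qed.

End BinaryGeneration.

(** * The two avoidance classes *)

Lemma card_avoiders1 p q : 1 < size p -> 1 < size q ->
  #|avoiders 1 [:: p; q]| = 1.
Proof.
have av s r : 1 < size r -> avoids (@one_line 1 s) r.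
  move=> r1; rewrite /avoids /contains size_one_line; apply/existsP => -[f].
  move/forallP/(_ (Ordinal (ltnW r1))).
  move/forallP/(_ (Ordinal r1)) => /andP[/= lt01 _].
  by move: lt01; rewrite (ord1 (f (Ordinal r1))).
move=> p1 q1; rewrite -[RHS]/(1`!) -card_Sn; apply: eq_card => s.
by rewrite !inE /= !av.
Qed.

(** Supplies the last letter of a forbidden pattern whose first two letters are the prepended letter
    and the head of [s]. *)
Lemma after_head n (s : 'S_n.+1) (v : nat) :
  v < n.+1 -> v != s ord0 -> exists2 k : 'I_n.+1, 0 < k & s k = v :> nat.
Proof.
move=> ltv vh; exists ((s^-1)%g (Ordinal ltv)); last by rewrite permKV.
by rewrite lt0n; apply: contra_neq vh => /(@val_inj _ _ _ _ ord0) <-;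
  rewrite permKV.
Qed.

Lemma head_neq n (s : 'S_n.+1) (j k : 'I_n.+1) : j < k -> (s k : nat) != s ord0.
Proof.
move=> jk; rewrite val_eqE (inj_eq perm_inj) -val_eqE -lt0n.
exact: leq_ltn_trans jk.
Qed.

Lemma neq_head n (s : 'S_n.+1) (j : 'I_n.+1) :
  (s j : nat) != s ord0 -> 0 < j.
Proof. by rewrite val_eqE (inj_eq perm_inj) -val_eqE -lt0n. Qed.

(* If c exceeds h + 1, then c, h, h + 1 form the pattern 312. *)
Lemma lift0_avoids312_le n (c : 'I_n.+2) (s : 'S_n.+1) :
  avoids (one_line (lift_perm ord0 c s)) [:: 3; 1; 2] -> c <= (s ord0).+1.
Proof.
rewrite lift0_avoids // => /andP[_ /forallP/(_ ord0)/forallP cP].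
rewrite leqNgt; apply/negP => hc.
have [||k k0 sk] := @after_head n s (s ord0).+1.
- by have := ltn_ord c; lia.
- by rewrite gtn_eqF.
by have := cP k; rewrite k0 sk /=; lia.
Qed.

Lemma lift0_avoids312 n (c : 'I_n.+2) (s : 'S_n.+1) :
  avoids (one_line s) [:: 3; 1; 2] -> c <= (s ord0).+1 ->
  avoids (one_line (lift_perm ord0 c s)) [:: 3; 1; 2].
Proof.
move=> av ch; rewrite lift0_avoids // av.
apply/forallP=> j; apply/forallP=> k; apply/implyP=> jk.
apply/negP => /and3P[/eqP cj /eqP ck /eqP sjk].
have nk := head_neq s jk.
(* Here [s j < s k < c <= h + 1] and [s k] differs from the head h, so [s k < h] and h, [s j], [s k]
   is already a 312 in [s]. *)
case/containsP: av => //; exists ord0, j, k.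
by split=> //=; [apply: (@neq_head _ s)|..]; lia.
Qed.

Lemma avoiders_312_132_lift0 n (c : 'I_n.+2) (s : 'S_n.+1) :
  (lift_perm ord0 c s \in avoiders n.+2 [:: [:: 3; 1; 2]; [:: 1; 3; 2]]) =
  (s \in avoiders n.+1 [:: [:: 3; 1; 2]; [:: 1; 3; 2]]) &&
  ((c == widen_ord (leqnSn n.+1) (s ord0)) || (c == lift ord0 (s ord0))).
Proof.
rewrite !inE /= !andbT -!val_eqE /= /bump /= add1n.
apply/andP/andP => [[av1 av2]|[/andP[av1 av2] ch]].
  have cle := lift0_avoids312_le av1.
  move: av1 av2; rewrite !lift0_avoids // => /andP[-> _] /andP[->].
  move=> /forallP/(_ ord0)/forallP cP; split=> //.
  suff : s ord0 <= c by lia.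
  rewrite leqNgt; apply/negP => ch.
  (* If c < h, the shift turns the old letters h and c into h + 1 and c + 1, so c, h + 1, c + 1 is a
     132. *)
  have [||k k0 sk] := @after_head n s c; [have := ltn_ord (s ord0); lia|lia|].
  by have := cP k; rewrite k0 sk /=; lia.
split; first by apply: lift0_avoids312 => //; lia.
rewrite lift0_avoids // av2.
apply/forallP=> j; apply/forallP=> k; apply/implyP=> jk.
apply/negP => /and3P[/eqP cj /eqP ck /eqP sjk].
have nk := head_neq s jk; have njk : (s j : nat) != s k.
  by rewrite val_eqE (inj_eq perm_inj) -val_eqE ltn_eqF.
(* From [h <= c <= s k < s j] and [s k != h], the letter c of a 132 can be replaced by h. *)
case/containsP: av2 => //; exists ord0, j, k.
by split=> //=; [apply: (@neq_head _ s)|..]; lia.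
Qed.

Lemma avoiders_312_231_lift0 n (c : 'I_n.+2) (s : 'S_n.+1) :
  (lift_perm ord0 c s \in avoiders n.+2 [:: [:: 3; 1; 2]; [:: 2; 3; 1]]) =
  (s \in avoiders n.+1 [:: [:: 3; 1; 2]; [:: 2; 3; 1]]) &&
  ((c == ord0) || (c == lift ord0 (s ord0))).
Proof.
rewrite !inE /= !andbT -!val_eqE /= /bump /= add1n.
apply/andP/andP => [[av1 av2]|[/andP[av1 av2] ch]].
  have cle := lift0_avoids312_le av1.
  move: av1 av2; rewrite !lift0_avoids // => /andP[-> _] /andP[->].
  move=> /forallP/(_ ord0)/forallP cP; split=> //.
  suff : ~~ (0 < c <= s ord0) by lia.
  apply/negP => ch.
  (* If 0 < c <= h, the old letter 0 is not shifted, so c, h + 1, 0 is a 231. *)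
  have [||k k0 sk] := @after_head n s 0; [by []|lia|].
  by have := cP k; rewrite k0 sk /=; lia.
split; first by apply: lift0_avoids312 => //; lia.
rewrite lift0_avoids // av2.
apply/forallP=> j; apply/forallP=> k; apply/implyP=> jk.
apply/negP => /and3P[/eqP cj /eqP ck /eqP sjk].
have nk := head_neq s jk.
(* As [s k < c], the letter c is not 0, so c = h + 1. Then [s k < h < s j], and h can replace c in
   the 231. *)
case/containsP: av2 => //; exists ord0, j, k.
by split=> //=; [apply: (@neq_head _ s)|..]; lia.
Qed.

Theorem theorem3p18 (n : nat) (sigma : seq nat) :
  1 <= n ->
  sigma \in [:: [:: 1; 3; 2]; [:: 2; 3; 1]] ->
  d n [:: [:: 3; 1; 2]; sigma] = jacobsthal n.-1.
Proof.
case: n => // n _; rewrite d_avoiders !inE => /orP[]/eqP->.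
  apply: (card_binary_desarrangements
    (A := fun m => avoiders m [:: [:: 3; 1; 2]; [:: 1; 3; 2]])
    (u := fun m h => widen_ord (leqnSn m.+1) h)) => //.
  - exact: avoiders_312_132_lift0.
  - exact: card_avoiders1.
apply: (card_binary_desarrangements
  (A := fun m => avoiders m [:: [:: 3; 1; 2]; [:: 2; 3; 1]])
  (u := fun m h => ord0)) => //.
- exact: avoiders_312_231_lift0.
- exact: card_avoiders1.
Qed.
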